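(* Let $(X,d)$ be a metric space with $|X|\geqslant 3$, and let $T\colon X\to X$ be a mapping contracting perimeters of triangles with a constant $\alpha$ satisfying $0\leqslant\alpha<\frac14$. Then $T$ is a generalized Chatterjea type mapping with respect to the metric $d$.
   Context: Let $(X,d)$ be a metric space with $|X|\geqslant 3$. A mapping $T\colon X\to X$ is a mapping contracting perimeters of triangles with constant $\alpha\in[0,1)$ if $$d(Tx,Ty)+d(Ty,Tz)+d(Tx,Tz)\leqslant\alpha\,(d(x,y)+d(y,z)+d(x,z))$$ holds for all three pairwise distinct points $x,y,z\in X$. A mapping $T\colon X\to X$ is a generalized Chatterjea type mapping on $X$ if there exists $\gamma\in[0,\frac13)$ such that $$d(Tx,Ty)+d(Ty,Tz)+d(Tx,Tz)\leqslant \gamma\,(d(x,Ty)+d(x,Tz)+d(y,Tx)+d(y,Tz)+d(z,Tx)+d(z,Ty))$$ holds for all three pairwise distinct points $x,y,z\in X$. *)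

(* Defs.v *)
From HB Require Import structures.
From mathcomp Require Import all_boot all_order all_algebra.
From mathcomp Require Import all_classical all_reals all_analysis.

Set Implicit Arguments.
Unset Strict Implicit.
Unset Printing Implicit Defensive.

Import Order.TTheory GRing.Theory Num.Theory.
Local Open Scope ring_scope.

Definition contracts_perimeters (R : realType) (X : metricType R)
    (T : X -> X) (alpha : R) : Prop :=
  0 <= alpha < 1 /\
  forall x y z : X, x != y -> y != z -> x != z ->
    mdist (T x) (T y) + mdist (T y) (T z) + mdist (T x) (T z)
      <= alpha * (mdist x y + mdist y z + mdist x z).

Definition generalized_Chatterjea (R : realType) (X : metricType R)
    (T : X -> X) : Prop :=
  exists2 gamma : R, 0 <= gamma < 1 / 3 &
  forall x y z : X, x != y -> y != z -> x != z ->
    mdist (T x) (T y) + mdist (T y) (T z) + mdist (T x) (T z)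
      <= gamma * (mdist x (T y) + mdist x (T z) + mdist y (T x)
                  + mdist y (T z) + mdist z (T x) + mdist z (T y)).

(* Main.v *)
(* The distance between two of the points x, y, z is at most the length of the
   detour through the image of the third; summing, the perimeter of the triangle
   is bounded by the Chatterjea sum, so gamma := alpha works. *)
Require Import Defs.
From HB Require Import structures.
From mathcomp Require Import all_boot all_order all_algebra.
From mathcomp Require Import all_classical all_reals all_analysis.
From mathcomp Require Import lra.

Set Implicit Arguments.
Unset Strict Implicit.
Unset Printing Implicit Defensive.

Import Order.TTheory GRing.Theory Num.Theory.
Local Open Scope classical_set_scope.
Local Open Scope card_scope.
Local Open Scope ring_scope.

Theorem proposition2p4 (R : realType) (X : metricType R)
  (cardX : `I_3 #<= [set: X]) (T : X -> X) (alpha : R)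
  (Talpha : contracts_perimeters T alpha) (alpha_lt : 0 <= alpha < 1 / 4) :
  generalized_Chatterjea T.
Proof.
have [alpha_ge0 alpha_lt4] := andP alpha_lt.
(* The witness is admissible because [alpha < 1/4] and 1/4 < 1/3. *)
case: Talpha => _ Tper; exists alpha; first by apply/andP; split; lra.
move=> x y z xy yz xz; apply: (le_trans (Tper x y z xy yz xz)).
(* As [alpha >= 0], it remains to compare the perimeter with the Chatterjea sum. *)
apply: ler_wpM2l => //.
(* The three detours have six legs, which are the six Chatterjea terms, each occurring once;
   symmetry turns every leg into the form point-to-image, so that [lra] only has to add up. *)
have := metric_triangle x (T z) y; rewrite (metric_sym (T z) y).
have := metric_triangle y (T x) z; rewrite (metric_sym (T x) z).
have := metric_triangle x (T y) z; rewrite (metric_sym (T y) z).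
lra.
Qed.
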